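(* Let $\mathcal{M}$ be an $n$-dimensional smooth oriented manifold and let $\overline{\varphi}=(\overline{\varphi}_o,v):\mathcal{M}\to\mathcal{Q}$ be a smooth map, with associated bundles $E_T,E_N\to\mathcal{M}$, connection $\nabla^N$ on $E_N$, and $1$-form $\beta=-\overline{\varphi}^*\alpha\in\Omega^1(\mathcal{M},E_N)$. (1) If $\varphi:\mathcal{M}\to\mathbb{R}^m$ is an immersion whose affine Gauss map is $\overline{\varphi}$, then $s:=\varphi-v$ is a section of $E_N$ and satisfies $$\nabla^N s=\beta.$$ (2) Conversely, if $s\in\Gamma(E_N)$ is a solution of $\nabla^N s=\beta$, and if $\varphi:=s+v:\mathcal{M}\to\mathbb{R}^m$ is an immersion which preserves orientation (i.e. $d\varphi:T\mathcal{M}\to E_T$ preserves orientations), then $\varphi$ has affine Gauss map $\overline{\varphi}$. The problem of finding an immersion with affine Gauss map $\overline{\varphi}$ thus reduces to that of finding a solution $s$ of $\nabla^N s=\beta$ such that $s+v$ is an immersion preserving orientation.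
   Context: Let $m=n+k$. $\mathcal{Q}_o\subset\Lambda^n\mathbb{R}^m$ is the Grassmannian of oriented linear $n$-planes of Euclidean $\mathbb{R}^m$ (an oriented plane with positive orthonormal basis $(e_1,\dots,e_n)$ is represented by $e_1\wedge\dots\wedge e_n$). Over $\mathcal{Q}_o$ there are the tautological bundles $\tau_T=\{(p_o,v)\in\mathcal{Q}_o\times\mathbb{R}^m: v\in p_o\}$ and $\tau_N=\{(p_o,v)\in\mathcal{Q}_o\times\mathbb{R}^m: v\in p_o^\perp\}$. $\mathcal{Q}$ is the Grassmannian of oriented affine $k$-planes of $\mathbb{R}^m$; each such plane is uniquely $v+p_o^\perp$ with $p_o\in\mathcal{Q}_o$, $v\in p_o$, so $\mathcal{Q}$ is identified with $\tau_T$, and its points are written $p=(p_o,v)$. Let $\pi:\mathcal{Q}\to\mathcal{Q}_o$, $(p_o,v)\mapsto p_o$. $T_{p_o}\mathcal{Q}_o$ is identified with the space $L(p_o,p_o^\perp)$ of linear maps $p_o\to p_o^\perp$: the linear map $u$ corresponds to $\sum_{i=1}^n e_1\wedge\dots\wedge u(e_i)\wedge\dots\wedge e_n$ ($u(e_i)$ in $i$-th position). The canonical $\tau_N$-valued $1$-form $\alpha$ on $\mathcal{Q}$ is $\alpha_p(\xi)=d\pi_p(\xi)(v)\in p_o^\perp$ for $p=(p_o,v)$, $\xi\in T_p\mathcal{Q}$. For $\overline{\varphi}=(\overline{\varphi}_o,v):\mathcal{M}\to\mathcal{Q}$ (so $\overline{\varphi}_o=\pi\circ\overline{\varphi}$ and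 $v:\mathcal{M}\to\mathbb{R}^m$, $v(x)\in\overline{\varphi}_o(x)$), set $E_T=\overline{\varphi}_o^*\tau_T$, $E_N=\overline{\varphi}_o^*\tau_N$; then $E_T\oplus E_N=\mathcal{M}\times\mathbb{R}^m$. Superscripts $T$, $N$ denote the components in this orthogonal splitting. The connections are $\nabla^T_X\xi_1=(d\xi_1(X))^T$ for $\xi_1\in\Gamma(E_T)$ and $\nabla^N_X\xi_2=(d\xi_2(X))^N$ for $\xi_2\in\Gamma(E_N)$. The affine Gauss map of an immersion $\varphi:\mathcal{M}\to\mathbb{R}^m$ is $x\mapsto\varphi(x)+(d\varphi_x(T_x\mathcal{M}))^\perp\in\mathcal{Q}$, i.e. $p_o=d\varphi_x(T_x\mathcal{M})$ with the orientation induced from $\mathcal{M}$, and the component $v(x)$ is the orthogonal projection of $\varphi(x)$ on $d\varphi_x(T_x\mathcal{M})$. *)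

(* Defs.v *)
(* MathComp-Analysis; vectors of R^m are row vectors, linear maps act on the
   right, and the Euclidean product of u and v is the 1x1 matrix u *m v^T. *)
From HB Require Import structures.
From mathcomp Require Import all_boot all_order all_algebra.
From mathcomp Require Import all_classical all_reals all_analysis.

Set Implicit Arguments.
Unset Strict Implicit.
Unset Printing Implicit Defensive.

Import Order.TTheory GRing.Theory Num.Theory.
Import numFieldNormedType.Exports.

Local Open Scope classical_set_scope.
Local Open Scope ring_scope.

(* Meaningful on open sets U only: there the iterated directional derivatives
   do not see the values of f outside U. *)
Fixpoint Ck_on (R : realType) (V W : normedModType R) (k : nat) (U : set V)
    (f : V -> W) : Prop :=
  match k with
  | 0%N => {in U, continuous f}
  | k'.+1 => {in U, forall y, differentiable f y} /\
             forall v : V, Ck_on k' U ('D_v f)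
  end.

Definition smooth_on (R : realType) (V W : normedModType R) (U : set V)
  (f : V -> W) : Prop := forall k, Ck_on k U f.

Record chart (R : realType) (n : nat) (T : topologicalType) := Chart {
  chart_dom : set T;
  chart_fwd : T -> 'rV[R]_n;
  chart_inv : 'rV[R]_n -> T;
  chart_dom_open : open chart_dom;
  chart_cod_open : open (chart_fwd @` chart_dom);
  chart_fwdK : {in chart_dom, cancel chart_fwd chart_inv};
  chart_fwd_continuous : {in chart_dom, continuous chart_fwd};
  chart_inv_continuous : {in chart_fwd @` chart_dom, continuous chart_inv}
}.

Definition chart_cod (R : realType) (n : nat) (T : topologicalType)
  (c : chart R n T) : set 'rV[R]_n := chart_fwd c @` chart_dom c.

Definition transition (R : realType) (n : nat) (T : topologicalType)
  (c c' : chart R n T) : 'rV[R]_n -> 'rV[R]_n := chart_fwd c' \o chart_inv c.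

(* The orientation is carried by the atlas: all its charts are positive. *)
Record orientedManifold (R : realType) (n : nat) := OrientedManifold {
  carrier :> topologicalType;
  atlas_index : Type;
  atlas : atlas_index -> chart R n carrier;
  manifold_hausdorff : hausdorff_space carrier;
  manifold_second_countable : @second_countable carrier;
  atlas_cover : forall x : carrier, exists i, chart_dom (atlas i) x;
  atlas_smooth : forall i j,
    smooth_on (chart_fwd (atlas i) @`
                (chart_dom (atlas i) `&` chart_dom (atlas j)))
              (transition (atlas i) (atlas j));
  atlas_oriented : forall i j x,
    chart_dom (atlas i) x -> chart_dom (atlas j) x ->
    0 < \det ('J (transition (atlas i) (atlas j)) (chart_fwd (atlas i) x))
}.

Arguments atlas {R n} _ _.
Arguments atlas_index {R n} _.

Definition index_at (R : realType) (n : nat) (M : orientedManifold R n)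
  (x : M) : atlas_index M := projT1 (cid (atlas_cover x)).

(* A tangent vector is given by its coordinates in all charts around x, related
   by the differentials of the transition maps; the coordinates in the charts
   not containing x are set to 0 so that equality is equality in T_x M. *)
Record tangent (R : realType) (n : nat) (M : orientedManifold R n) (x : M) :=
  Tangent {
  tcoord : atlas_index M -> 'rV[R]_n;
  tcoord_transition : forall i j,
    chart_dom (atlas M i) x -> chart_dom (atlas M j) x ->
    tcoord j =
      'd (transition (atlas M i) (atlas M j)) (chart_fwd (atlas M i) x)
        (tcoord i);
  tcoord_out : forall i, ~ chart_dom (atlas M i) x -> tcoord i = 0
}.

Definition smooth (R : realType) (n : nat) (M : orientedManifold R n)
  (W : normedModType R) (f : M -> W) : Prop :=
  forall i, smooth_on (chart_cod (atlas M i)) (f \o chart_inv (atlas M i)).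

(* For differentiable f the result does not depend on the chart around x. *)
Definition dmap (R : realType) (n : nat) (M : orientedManifold R n)
  (W : normedModType R) (f : M -> W) (x : M) (X : tangent x) : W :=
  'd (f \o chart_inv (atlas M (index_at x)))
     (chart_fwd (atlas M (index_at x)) x) (tcoord X (index_at x)).

Definition immersion (R : realType) (n : nat) (M : orientedManifold R n)
  (W : normedModType R) (f : M -> W) : Prop :=
  smooth f /\ forall x : M, injective (@dmap R n M W f x).

Definition positive_basis (R : realType) (n : nat) (M : orientedManifold R n)
  (x : M) (X : 'I_n -> tangent x) : Prop :=
  0 < \det (\matrix_(i < n) tcoord (X i) (index_at x)).

Definition dmap_rows (R : realType) (n m : nat) (M : orientedManifold R n)
  (f : M -> 'rV[R]_m) (x : M) (X : 'I_n -> tangent x) : 'M[R]_(n, m) :=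
  \matrix_(i < n) dmap f (X i).

Definition multi_index (n m : nat) : {set {ffun 'I_n -> 'I_m}} :=
  [set J : {ffun 'I_n -> 'I_m} |
    [forall i : 'I_n, forall j : 'I_n, (i < j)%N ==> (J i < J j)%N]]%SET.

(* The n-th exterior power of R^m, in coordinates with respect to the basis
   e_J(1) /\ ... /\ e_J(n), J strictly increasing. *)
Notation Lambda R n m := 'rV[R]_#|multi_index n m|.

(* v_1 /\ ... /\ v_n for the rows v_i of e; its coordinates are the minors. *)
Definition wedge (R : realType) (n m : nat) (e : 'M[R]_(n, m)) : Lambda R n m :=
  \row_J \det (colsub (enum_val J : {ffun 'I_n -> 'I_m}) e).

Definition positive_onb (R : realType) (n m : nat) (w : Lambda R n m)
  (e : 'M[R]_(n, m)) : Prop := e *m e^T = 1%:M /\ wedge e = w.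

Definition Qo (R : realType) (n m : nat) : set (Lambda R n m) :=
  [set w | exists e, positive_onb w e].

(* For w in Qo, two positive orthonormal bases differ by a rotation; what is
   defined below from frame w does not depend on the choice made here. *)
Definition frame (R : realType) (n m : nat) (w : Lambda R n m) : 'M[R]_(n, m) :=
  get [set e | positive_onb w e].

Definition in_plane (R : realType) (n m : nat) (w : Lambda R n m)
  (v : 'rV[R]_m) : Prop := (v <= frame w)%MS.

Definition in_perp (R : realType) (n m : nat) (w : Lambda R n m)
  (v : 'rV[R]_m) : Prop := v *m (frame w)^T = 0.

(* \sum_i <v, e_i> e_i *)
Definition projT (R : realType) (n m : nat) (w : Lambda R n m)
  (v : 'rV[R]_m) : 'rV[R]_m := v *m (frame w)^T *m frame w.

Definition projN (R : realType) (n m : nat) (w : Lambda R n m)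
  (v : 'rV[R]_m) : 'rV[R]_m := v - projT w v.

(* The oriented affine plane v + w^perp is the pair (w, v), v in w. Q is a
   submanifold of the vector space Lambda R n m * R^m; maps to Q and tangent
   vectors of Q are regarded as maps to, and vectors of, that space. *)
Definition Q (R : realType) (n m : nat) : set (Lambda R n m * 'rV[R]_m) :=
  [set p | Qo p.1 /\ in_plane p.1 p.2].

(* Linear maps from the plane w to its orthogonal complement, each represented
   by its unique extension to R^m vanishing on that complement. *)
Definition Lperp (R : realType) (n m : nat) (w : Lambda R n m) :
    set 'M[R]_m :=
  [set u | (forall v, in_plane w v -> in_perp w (v *m u)) /\
           (forall v, in_perp w v -> v *m u = 0)].

(* \sum_i e_1 /\ ... /\ u(e_i) /\ ... /\ e_n *)
Definition tangent_of_hom (R : realType) (n m : nat) (w : Lambda R n m)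
  (u : 'M[R]_m) : Lambda R n m :=
  \sum_(i < n) wedge (\matrix_(j < n)
    (if j == i then row j (frame w) *m u else row j (frame w))).

Definition hom_of_tangent (R : realType) (n m : nat) (w eta : Lambda R n m) :
  'M[R]_m := get [set u | Lperp w u /\ tangent_of_hom w u = eta].

(* The projection Q -> Qo being p |-> p.1, its differential is xi |-> xi.1. *)
Definition alpha (R : realType) (n m : nat) (p xi : Lambda R n m * 'rV[R]_m) :
  'rV[R]_m := p.2 *m hom_of_tangent p.1 xi.1.

Definition smooth_to_Q (R : realType) (n m : nat) (M : orientedManifold R n)
  (phibar : M -> Lambda R n m * 'rV[R]_m) : Prop :=
  smooth phibar /\ forall x, Q (phibar x).

Definition beta (R : realType) (n m : nat) (M : orientedManifold R n)
  (phibar : M -> Lambda R n m * 'rV[R]_m) (x : M) (X : tangent x) : 'rV[R]_m :=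
  - alpha (phibar x) (dmap phibar X).

Definition section_EN (R : realType) (n m : nat) (M : orientedManifold R n)
  (phibar : M -> Lambda R n m * 'rV[R]_m) (s : M -> 'rV[R]_m) : Prop :=
  smooth s /\ forall x, in_perp (phibar x).1 (s x).

Definition nablaN (R : realType) (n m : nat) (M : orientedManifold R n)
  (phibar : M -> Lambda R n m * 'rV[R]_m) (s : M -> 'rV[R]_m)
  (x : M) (X : tangent x) : 'rV[R]_m := projN (phibar x).1 (dmap s X).

(* d f (T_x M) with the orientation induced from M: the element of Qo having a
   positive orthonormal basis that is the image of a positive basis of T_x M. *)
Definition gauss_plane (R : realType) (n m : nat) (M : orientedManifold R n)
  (f : M -> 'rV[R]_m) (x : M) : Lambda R n m :=
  get [set w | exists X : 'I_n -> tangent x,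
         positive_basis X /\ positive_onb w (dmap_rows f X)].

Definition affine_gauss_map (R : realType) (n m : nat)
  (M : orientedManifold R n) (f : M -> 'rV[R]_m) (x : M) :
  Lambda R n m * 'rV[R]_m :=
  (gauss_plane f x, projT (gauss_plane f x) (f x)).

(* The coordinates of the E_T-components of the d f (X_i) in a positive
   orthonormal basis have positive determinant. Taking components avoids
   requiring d f to be E_T-valued; if it is, this says that d f : TM -> E_T
   maps positive bases to positive bases. *)
Definition preserves_orientation (R : realType) (n m : nat)
  (M : orientedManifold R n) (phibar : M -> Lambda R n m * 'rV[R]_m)
  (f : M -> 'rV[R]_m) : Prop :=
  forall (x : M) (X : 'I_n -> tangent x), positive_basis X ->
    0 < \det (dmap_rows f X *m (frame (phibar x).1)^T).

(* Main.v *)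
(* Write <w, f> for the pairing of w in Lambda^n R^m with f_1 /\ ... /\ f_n; by
   Cauchy-Binet, <e_1 /\ ... /\ e_n, f> = det (f e^T). If w represents a plane
   and v lies in it, Cramer's rule gives, for all y,
     <w, f> <y, v> = \sum_i <w, f[f_i := y]> <f_i, v>.
   Differentiating this along a curve (w, v) in Q, with f an orthonormal basis e
   of w and y normal to w, gives <y, dv> = \sum_i <e_i, v> <dw, e[e_i := y]>,
   which says that the normal part of dv is u(v), u being the map identified
   with dw: so (dv)^N = alpha. Differentiating the Pluecker relations shows
   that dw is indeed of the form \sum_i e_1 /\ ... /\ u(e_i) /\ ... /\ e_n. Hence, for
   phi = s + v, (d phi)^N = nabla^N s - beta, and nabla^N s = beta says that
   d phi takes its values in E_T. *)
Require Import Defs.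
From HB Require Import structures.
From mathcomp Require Import all_boot all_order fingroup perm all_algebra.
From mathcomp Require Import all_classical all_reals all_analysis.

Set Implicit Arguments.
Unset Strict Implicit.
Unset Printing Implicit Defensive.

Import Order.TTheory GRing.Theory Num.Theory.
Import numFieldNormedType.Exports.

Local Open Scope classical_set_scope.
Local Open Scope ring_scope.

(** * The Cauchy-Binet formula *)

Lemma multi_indexP (n m : nat) (J : {ffun 'I_n -> 'I_m}) :
  reflect {homo J : i j / (i < j)%N} (J \in multi_index n m).
Proof.
rewrite inE; apply: (iffP forallP) => [h i j ij|h i].
  by have /forallP/(_ j)/implyP := h i; apply.
by apply/forallP => j; apply/implyP; exact: h.
Qed.

Lemma multi_index_inj (n m : nat) (J : {ffun 'I_n -> 'I_m}) :
  J \in multi_index n m -> injective J.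
Proof.
move=> /multi_indexP incJ i j Jij; apply/val_inj/eqP.
by case: ltngtP => // /incJ; rewrite Jij ltnn.
Qed.

Lemma multi_index_sorted (n m : nat) (J : {ffun 'I_n -> 'I_m}) :
  J \in multi_index n m -> sorted ltn [seq val (J i) | i <- enum 'I_n].
Proof.
move=> /multi_indexP incJ; rewrite sorted_map.
suff : sorted (relpre val ltn) (enum 'I_n) by apply: sub_sorted => i j /incJ.
by rewrite -sorted_map val_enum_ord iota_ltn_sorted.
Qed.

(** [J] and [J'] list the same set of values, both in strictly increasing order, so they agree as
    sorted lists; injectivity then identifies the permutations. *)
Lemma multi_index_perm_inj (n m : nat) (J J' : {ffun 'I_n -> 'I_m})
    (s s' : 'S_n) : J \in multi_index n m -> J' \in multi_index n m ->
  (forall i, J (s i) = J' (s' i)) -> J = J' /\ s = s'.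
Proof.
move=> Jinc J'inc JJ'.
suff eqJ : J = J'.
  split=> //; apply/permP => i; apply: (multi_index_inj Jinc).
  by rewrite JJ' eqJ.
suff /eq_in_map h : [seq val (J i) | i <- enum 'I_n] =
                    [seq val (J' i) | i <- enum 'I_n].
  by apply/ffunP => i; apply/val_inj/h; rewrite mem_enum.
apply: (irr_sorted_eq ltn_trans ltnn); do ?exact: multi_index_sorted.
move=> k; apply/mapP/mapP => -[i _ ->].
  by exists (s' ((s^-1)%g i)); rewrite ?mem_enum// -JJ' permKV.
by exists (s ((s'^-1)%g i)); rewrite ?mem_enum// JJ' permKV.
Qed.

(** The values of [f] are sorted; injectivity excludes repetitions, so the sorted list is strictly
    increasing. *)
Lemma multi_index_sort (n m : nat) (f : {ffun 'I_n -> 'I_m}) : injective f ->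
  exists2 J, J \in multi_index n m & exists s : 'S_n, forall i, f i = J (s i).
Proof.
move=> injf; set le := relpre val leq : rel 'I_m.
have le_total : total le by move=> i j; exact: leq_total.
set t := [tuple of sort le [tuple f i | i < n]].
have tE : val t = sort le [seq f i | i <- enum 'I_n] by [].
have Jinc : [ffun i => tnth t i] \in multi_index n m.
  have t_sorted : sorted ltn (map val t).
    rewrite ltn_sorted_uniq_leq (map_inj_uniq val_inj) sorted_map tE.
    by rewrite sort_uniq map_inj_uniq // enum_uniq sort_sorted.
  apply/multi_indexP => i j ij; rewrite !ffunE.
  have ti (l : 'I_n) : val (tnth t l) = nth 0 (map val t) l.
    by rewrite (nth_map (tnth t l)) ?size_tuple // -tnth_nth.
  rewrite !ti; apply: (sorted_ltn_nth ltn_trans) => //;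
    by rewrite inE size_map size_tuple.
exists [ffun i => tnth t i] => //.
have /tuple_permP[s fs] : perm_eq [tuple f i | i < n] t.
  by rewrite perm_sym; exact/permPl/perm_sort.
exists s => i; rewrite ffunE.
have /val_inj/(congr1 (fun u => tnth u i)) := fs.
by rewrite !tnth_mktuple.
Qed.

Lemma colsub_perm_det (R : comPzRingType) (n m : nat) (f : 'I_n -> 'I_m)
    (s : 'S_n) (B : 'M[R]_(n, m)) :
  \det (colsub (f \o s) B) = (-1) ^+ s * \det (colsub f B).
Proof.
have -> : colsub (f \o s) B = col_perm s (colsub f B).
  by apply/matrixP => i j; rewrite !mxE.
by rewrite col_permE det_mulmx det_perm mulrC odd_permV.
Qed.

(** Multilinearity in the rows gives a sum over all maps [f]. Non-injective [f] select two equal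
    columns and contribute 0. The others factor uniquely as an increasing [J] after a permutation
    [s], and the signed sum over [s] rebuilds the minor of [A]. *)
Lemma Cauchy_Binet (R : comPzRingType) (n m : nat) (A B : 'M[R]_(n, m)) :
  \det (A *m B^T) =
  \sum_(J in multi_index n m) \det (colsub J A) * \det (colsub J B).
Proof.
pose F (f : {ffun 'I_n -> 'I_m}) := (\prod_i A i (f i)) * \det (colsub f B).
have -> : \det (A *m B^T) = \sum_f F f.
  have detE s : \prod_i (A *m B^T) i ((s : 'S_n) i) =
      \sum_(f : {ffun 'I_n -> 'I_m}) \prod_i (A i (f i) * B (s i) (f i)).
    rewrite -(bigA_distr_bigA (fun i j => A i j * B (s i) j)).
    by apply: eq_bigr => i _; rewrite mxE; apply: eq_bigr => j _; rewrite mxE.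
  rewrite {1}/determinant; under eq_bigr do rewrite detE mulr_sumr.
  rewrite exchange_big /=; apply: eq_bigr => f _.
  rewrite /F -det_tr mulr_sumr; apply: eq_bigr => s _.
  rewrite big_split /= mulrCA; congr (_ * (_ * _)).
  by apply: eq_bigr => i _; rewrite !mxE.
rewrite (bigID (fun f : {ffun 'I_n -> 'I_m} => injectiveb f)) /=.
rewrite [X in _ + X]big1 ?addr0; last first.
  move=> f /injectivePn[i [j ij fij]]; rewrite /F -det_tr.
  rewrite (determinant_alternate ij) ?mulr0 // => l.
  by rewrite !mxE fij.
pose h (p : {ffun 'I_n -> 'I_m} * 'S_n) := [ffun i => p.1 (p.2 i)].
pose D := [set p : {ffun 'I_n -> 'I_m} * 'S_n | p.1 \in multi_index n m]%SET.
have memD p : (p \in D) = (p.1 \in multi_index n m) by rewrite inE.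
have injh : {in D &, injective h}.
  move=> [J s] [J' s']; rewrite !memD /= => Jinc J'inc /ffunP JJ'.
  have [] := multi_index_perm_inj (s := s) (s' := s') Jinc J'inc.
    by move=> i; have := JJ' i; rewrite !ffunE.
  by move=> -> ->.
have -> : \sum_(f : {ffun 'I_n -> 'I_m} | injectiveb f) F f =
          \sum_(f in [set h p | p in D]%SET) F f.
  apply: eq_bigl => f; apply/idP/imsetP => [/injectiveP/multi_index_sort|].
    move=> [J Jinc [s fs]]; exists (J, s); first by rewrite memD.
    by apply/ffunP => i; rewrite !ffunE.
  move=> [[J s] + ->]; rewrite memD /= => Jinc; apply/injectiveP => i j.
  by rewrite !ffunE => /(multi_index_inj Jinc)/perm_inj.
rewrite (big_imset _ injh) /=.
rewrite (eq_bigl (fun p => (p.1 \in multi_index n m) && true)); last first.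
  by move=> p; rewrite memD andbT.
rewrite -(pair_big (mem (multi_index n m)) xpredT
  (fun J s => F (h (J, s)))) /=; apply: eq_bigr => J _.
rewrite mulr_suml; apply: eq_bigr => s _; rewrite /F.
have -> : colsub (h (J, s)) B = colsub (J \o s) B.
  by apply/matrixP => i j; rewrite !mxE ffunE.
rewrite colsub_perm_det mulrCA mulrA; congr (_ * _ * _).
by apply: eq_bigr => i _; rewrite !mxE ffunE.
Qed.

(** * Pairings with decomposable vectors *)

Definition subst_row (R : Type) (n m : nat) (i : 'I_n) (y : 'rV[R]_m)
    (f : 'M[R]_(n, m)) : 'M[R]_(n, m) :=
  \matrix_(j < n) (if j == i then y else row j f).

Lemma subst_rowE (R : Type) (n m : nat) (i : 'I_n) (y : 'rV[R]_m)
    (f : 'M[R]_(n, m)) j a :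
  subst_row i y f j a = if j == i then y 0 a else f j a.
Proof. by rewrite mxE; case: eqP => // _; rewrite mxE. Qed.

Lemma subst_row_mul (R : pzRingType) (n m p : nat) (i : 'I_n) (y : 'rV[R]_m)
    (f : 'M[R]_(n, m)) (B : 'M[R]_(m, p)) :
  subst_row i y f *m B = subst_row i (y *m B) (f *m B).
Proof.
apply/matrixP => j a; rewrite !subst_rowE !mxE.
by case: ifP => ji; apply: eq_bigr => b _; rewrite subst_rowE ji.
Qed.

(** Laplace expansion along row [i], whose cofactors do not involve that row. *)
Lemma det_subst_row (R : comPzRingType) (n : nat) (i : 'I_n) (y : 'rV[R]_n)
    (A : 'M[R]_n) : \det (subst_row i y A) = (y *m \adj A) 0 i.
Proof.
rewrite (expand_det_row _ i) mxE; apply: eq_bigr => j _.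
rewrite subst_rowE eqxx !mxE; congr (_ * (_ * \det _)).
by apply/matrixP => a b; rewrite !mxE eq_sym (negbTE (neq_lift _ _)) mxE.
Qed.

Definition pairing (R : realType) (n m : nat) (w : Lambda R n m)
  (f : 'M[R]_(n, m)) : R := \sum_J w 0 J * wedge f 0 J.

Section Pairing.
Context {R : realType} {n m : nat}.
Implicit Types (w : Lambda R n m) (e f : 'M[R]_(n, m)) (y v : 'rV[R]_m).

Lemma pairing_wedge e f : pairing (wedge e) f = \det (f *m e^T).
Proof.
rewrite Cauchy_Binet [RHS]big_enum_val; apply: eq_bigr => J _.
by rewrite !mxE mulrC.
Qed.

Lemma wedge_mul (B : 'M[R]_n) e : wedge (B *m e) = \det B *: wedge e.
Proof.
apply/rowP => J; rewrite !mxE -det_mulmx; congr (\det _).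
by apply/matrixP => i j; rewrite !mxE; apply: eq_bigr => l _; rewrite !mxE.
Qed.

(* Row i of polar w f represents the linear form
   y |-> pairing w (f_1 /\ ... /\ y /\ ... /\ f_n), with y in position i. *)
Definition polar w f : 'M[R]_(n, m) :=
  \matrix_(i < n, a < m) pairing w (subst_row i (delta_mx 0 a) f).

(** Each minor is linear in row [i], with cofactors as coefficients, by [det_subst_row]. *)
Lemma polarP w f y (i : 'I_n) :
  (y *m (polar w f)^T) 0 i = pairing w (subst_row i y f).
Proof.
rewrite mxE /pairing; under eq_bigr do rewrite !mxE mulr_sumr.
rewrite exchange_big; apply: eq_bigr => J _ /=.
pose K : {ffun 'I_n -> 'I_m} := enum_val J.
have colsub_subst z : \det (colsub K (subst_row i z f)) =
    ((\row_b z 0 (K b)) *m \adj (colsub K f)) 0 i.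
  rewrite -det_subst_row; congr (\det _); apply/matrixP => a b.
  by rewrite !(subst_rowE, mxE).
rewrite [in RHS]mxE colsub_subst mxE mulr_sumr.
under eq_bigr do rewrite mxE colsub_subst mxE mulrCA mulr_sumr.
under eq_bigr do rewrite mulr_sumr.
rewrite exchange_big; apply: eq_bigr => b _ /=; rewrite !mxE.
rewrite (bigD1 (K b)) //= big1 ?addr0; last first.
  by move=> a /negbTE ab; rewrite !mxE eq_sym ab !(mul0r, mulr0).
by rewrite !mxE !eqxx mul1r mulrCA.
Qed.

Lemma polar_wedge e f : polar (wedge e) f = (\adj (f *m e^T))^T *m e.
Proof.
apply/matrixP => i a; rewrite mxE pairing_wedge subst_row_mul det_subst_row.
have -> : (\adj (f *m e^T))^T *m e = (e^T *m \adj (f *m e^T))^T.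
  by rewrite trmx_mul trmxK.
by rewrite -mulmxA -rowE !mxE.
Qed.

Lemma pairing_subst e f y (i : 'I_n) :
  pairing (wedge e) (subst_row i y f) = (y *m e^T *m \adj (f *m e^T)) 0 i.
Proof. by rewrite pairing_wedge subst_row_mul det_subst_row. Qed.

(* Cramer's rule for the coordinates of v in the basis e. *)
Lemma pairing_cramer e f y v : (v <= e)%MS ->
  pairing (wedge e) f * (y *m v^T) 0 0 =
  \sum_i pairing (wedge e) (subst_row i y f) * (row i f *m v^T) 0 0.
Proof.
move=> /submxP[c ->]; rewrite trmx_mul.
(* The product of [f *m e^T] with its adjugate, a scalar matrix, is inserted between [y *m e^T] and
   the coordinates [c] of [v]. *)
transitivity ((y *m e^T *m \adj (f *m e^T) *m (f *m e^T *m c^T)) 0 0).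
  rewrite [in RHS]mulmxA -(mulmxA _ (\adj _)) mul_adj_mx mul_mx_scalar.
  by rewrite -scalemxAl [RHS]mxE pairing_wedge mulmxA.
rewrite mxE; apply: eq_bigr => i _; rewrite pairing_subst; congr (_ * _).
by rewrite -(mulmxA f) -row_mul [RHS]mxE.
Qed.

(* The Pluecker relations, expressing a decomposable w through its pairings. *)
Lemma pairing_wedge_polar e f :
  pairing (wedge e) f *: wedge (polar (wedge e) f) =
  pairing (wedge e) f ^+ n *: wedge e.
Proof.
(* The extra factor [pairing (wedge e) f] is the determinant of [f *m e^T]; multiplied by that of
   the adjugate it gives the exponent [n] instead of [n - 1]. *)
rewrite polar_wedge wedge_mul scalerA pairing_wedge det_tr -det_mulmx.
by rewrite mul_mx_adj det_scalar.
Qed.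

Lemma mulmx_tr_eq0 (p : nat) (A : 'M[R]_(p, m)) : A *m A^T = 0 -> A = 0.
Proof.
move=> A0; apply/matrixP => i j; rewrite mxE; apply/eqP.
have /eqP : (A *m A^T) i i = 0 by rewrite A0 mxE.
rewrite mxE psumr_eq0 => [/allP/(_ j)|k _]; rewrite mxE -expr2 ?sqr_ge0 //.
by rewrite mem_index_enum sqrf_eq0; exact.
Qed.

End Pairing.

(** * Orthonormal bases of an oriented plane, and its tangent vectors *)

Section OrientedPlane.
Context {R : realType} {n m : nat}.
Implicit Types (w : Lambda R n m) (e f : 'M[R]_(n, m)) (y v : 'rV[R]_m).

Lemma frameP w : Qo w -> positive_onb w (frame w).
Proof. exact: (@getPex _ [set e | positive_onb w e]). Qed.

Lemma pairing_onb w e : positive_onb w e -> pairing w e = 1.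
Proof. by case=> ee <-; rewrite pairing_wedge ee det1. Qed.

Lemma Qo_neq0 : ~ Qo (0 : Lambda R n m).
Proof.
move=> [e /pairing_onb]; rewrite /pairing big1 => [/eqP|J _].
  by rewrite eq_sym oner_eq0.
by rewrite mxE mul0r.
Qed.

(** The coordinates of [y *m e^T] are pairings of [w] with substituted bases, and these can also be
    computed from [e']. *)
Lemma onb_perp w e e' y : positive_onb w e -> positive_onb w e' ->
  y *m e'^T = 0 -> y *m e^T = 0.
Proof.
move=> [ee we] [_ we'] y0; apply/rowP => i.
have := pairing_subst e e y i.
by rewrite ee adj1 mulmx1 => <-; rewrite we -we' pairing_subst y0 mul0mx !mxE.
Qed.

(** The difference [d] of the two sides is normal to [e], hence to [e'] by [onb_perp]; being a
    combination of their rows, it satisfies [d *m d^T = 0]. *)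
Lemma onb_change w e e' : positive_onb w e -> positive_onb w e' ->
  e' = e' *m e^T *m e.
Proof.
move=> we we'; apply/subr0_eq/mulmx_tr_eq0.
set d := _ - _; have de : d *m e^T = 0.
  by rewrite mulmxBl -(mulmxA _ e) we.1 mulmx1 subrr.
have de' : d *m e'^T = 0.
  apply/row_matrixP => i; rewrite row0 row_mul.
  by apply: (onb_perp we' we); rewrite -row_mul de row0.
rewrite [in X in X^T]/d linearB /= trmx_mul mulmxBr de' mulmxA de mul0mx.
by rewrite subrr.
Qed.

(** The change of basis is an orthogonal matrix. This lets [projT] be computed in any positive
    orthonormal basis, not only in [frame w]. *)
Lemma onb_proj w e e' : positive_onb w e -> positive_onb w e' ->
  e^T *m e = e'^T *m e'.
Proof.
move=> we we'; have ee' := onb_change we we'.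
have e'e := onb_change we' we.
have CC : (e' *m e^T)^T *m (e' *m e^T) = 1%:M.
  by rewrite trmx_mul trmxK mulmxA -e'e we.1.
rewrite [in RHS]ee'; move: (e' *m e^T) CC => C CC.
by rewrite trmx_mul -mulmxA (mulmxA C^T) CC mul1mx.
Qed.

Lemma onb_change_det w e e' : positive_onb w e -> positive_onb w e' ->
  \det (e' *m e^T) = 1.
Proof.
by move=> we we'; rewrite -pairing_wedge we.2 (pairing_onb we').
Qed.

Lemma in_planeP w v : Qo w -> in_plane w v <-> projT w v = v.
Proof.
move=> /frameP [ee _]; split=> [/submxP[c ->]|<-]; last exact: submxMl.
by rewrite /projT -(mulmxA c) ee mulmx1.
Qed.

Lemma projN_perp w v : Qo w -> in_perp w (projN w v).
Proof.
move=> /frameP [ee _].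
by rewrite /in_perp /projN /projT mulmxBl -!mulmxA ee mulmx1 subrr.
Qed.

Lemma projNB w u v : projN w (u - v) = projN w u - projN w v.
Proof.
rewrite /projN /projT !mulmxBl !opprB addrACA [RHS]addrACA.
by congr (_ + _); exact: addrC.
Qed.

Lemma projT_onb w e v : positive_onb w e -> projT w v = v *m e^T *m e.
Proof.
move=> we; have Qw : Qo w by exists e.
by rewrite /projT -!mulmxA (onb_proj (frameP Qw) we).
Qed.

(** The difference [u - v] is itself an admissible test vector [y]. *)
Lemma perp_eq w u v : in_perp w u -> in_perp w v ->
  (forall y, in_perp w y -> (y *m u^T) 0 0 = (y *m v^T) 0 0) -> u = v.
Proof.
move=> uw vw uv; apply/subr0_eq/mulmx_tr_eq0.
apply/matrixP => i j; rewrite !ord1 linearB /= mulmxBr [LHS]mxE [X in _ + X]mxE.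
by rewrite uv ?subrr ?mxE // /in_perp mulmxBl uw vw subrr.
Qed.

Lemma tangent_of_homE w (u : 'M[R]_m) : tangent_of_hom w u =
  \sum_(i < n) wedge (subst_row i (row i (frame w *m u)) (frame w)).
Proof.
apply: eq_bigr => i _; congr wedge; apply/matrixP => j a.
rewrite subst_rowE !mxE; case: eqP => [->|_]; last by rewrite mxE.
by rewrite !mxE; apply: eq_bigr => b _; rewrite mxE.
Qed.

Lemma pairing_sum (I : finType) (W : I -> Lambda R n m) f :
  pairing (\sum_i W i) f = \sum_i pairing (W i) f.
Proof.
rewrite /pairing exchange_big; apply: eq_bigr => J _.
by rewrite summxE mulr_suml.
Qed.

(* Only the i-th term of the sum tangent_of_hom w u contributes. *)
Lemma pairing_tangent_of_hom w (u : 'M[R]_m) y (i : 'I_n) : Qo w ->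
  Lperp w u -> in_perp w y ->
  pairing (tangent_of_hom w u) (subst_row i y (frame w)) =
  (y *m (row i (frame w) *m u)^T) 0 0.
Proof.
move=> Qw [uperp _] yw; have [ee _] := frameP Qw; set e := frame w in ee *.
have eu j p : (e *m (row j e *m u)^T) p 0 = 0.
  suff -> : e *m (row j e *m u)^T = 0 by rewrite mxE.
  apply: trmx_inj; rewrite trmx_mul trmxK trmx0; apply: uperp.
  exact: row_sub.
(* The Gram matrix of [e] against [e] with its row [j] replaced by the normal vector u(e_j) is the
   identity with column [j] set to zero. *)
have eeE j p l : (e *m (subst_row j (row j (e *m u)) e)^T) p l =
    if l == j then 0 else (p == l)%:R.
  case: (eqVneq l j) => [->|lj].
    rewrite -[RHS](eu j p) [LHS]mxE [RHS]mxE; apply: eq_bigr => a _.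
    by rewrite [in LHS]mxE subst_rowE eqxx row_mul [in RHS]mxE.
  rewrite -[RHS](_ : (e *m e^T) p l = _); last by rewrite ee mxE.
  rewrite [LHS]mxE [RHS]mxE; apply: eq_bigr => a _.
  by rewrite [in LHS]mxE subst_rowE (negbTE lj) [in RHS]mxE.
rewrite tangent_of_homE pairing_sum (bigD1 i) //= big1 ?addr0 => [|j ji].
  rewrite pairing_wedge subst_row_mul.
  set b := y *m (subst_row _ _ _)^T.
  (* The zeroed column [i] differs from that of the identity only in row [i], which is overwritten
     by [b]. *)
  have -> : subst_row i b (e *m (subst_row i (row i (e *m u)) e)^T) =
      subst_row i b 1%:M.
    apply/matrixP => p l; rewrite !subst_rowE eeE [1%:M _ _]mxE.
    case: (eqVneq p i) => // pi; case: (eqVneq l i) => [->|//].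
    by rewrite (negbTE pi).
  rewrite det_subst_row adj1 mulmx1 /b [LHS]mxE [RHS]mxE; apply: eq_bigr => a _.
  by rewrite [in LHS]mxE subst_rowE eqxx row_mul [in RHS]mxE.
(* For [j] other than [i], row [j] survives the substitution and is zero. *)
rewrite pairing_wedge subst_row_mul (expand_det_row _ j) big1 // => l _.
by rewrite subst_rowE (negbTE ji) eeE; case: (eqVneq l j) => _; rewrite mul0r.
Qed.

Lemma hom_of_tangentP w eta :
    (exists u, Lperp w u /\ tangent_of_hom w u = eta) ->
  Lperp w (hom_of_tangent w eta) /\
  tangent_of_hom w (hom_of_tangent w eta) = eta.
Proof. exact: (@getPex _ [set u | Lperp w u /\ _]). Qed.

End OrientedPlane.

(** * Derivatives of maps to the Grassmannian *)

Section Derivatives.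
Context {R : realType} {V : normedModType R}.
Implicit Types (x X : V).

(** Used to differentiate the identities satisfied by all points of the Grassmannian. *)
Lemma is_derive_cst_eq0 (f : V -> R) x X (c df : R) :
  (forall z, f z = c) -> is_derive x X f df -> df = 0.
Proof.
move=> fc [_ <-]; rewrite (_ : f = cst c) ?derive_cst //.
exact/funext.
Qed.

Lemma is_derive_coord (p q : nat) (A : V -> 'M[R]_(p, q)) x X dA i j :
  is_derive x X A dA -> is_derive x X (fun z => A z i j) (dA i j).
Proof.
move=> [Ax <-]; rewrite derive_mx // mxE.
by apply: derivableP; move/derivable_mxP : Ax; exact.
Qed.

Lemma is_derive_mx (p q : nat) (A : V -> 'M[R]_(p, q)) x X
    (dA : 'M[R]_(p, q)) :
  (forall i j, is_derive x X (fun z => A z i j) (dA i j)) -> is_derive x X A dA.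
Proof.
move=> AdA; have Ax : derivable A x X.
  by apply/derivable_mxP => i j; have [] := AdA i j.
apply: DeriveDef => //; rewrite derive_mx //; apply/matrixP => i j.
by rewrite mxE; have [] := AdA i j.
Qed.

Lemma is_derive_bigsum (I : Type) (r : seq I) (h : I -> V -> R) x X dh :
  (forall i, is_derive x X (h i) (dh i)) ->
  is_derive x X (fun z => \sum_(i <- r) h i z) (\sum_(i <- r) dh i).
Proof.
move=> hdh; elim: r => [|i r IHr].
  rewrite big_nil (_ : (fun _ => _) = cst 0); first exact: is_derive_cst.
  by apply/funext => z; rewrite big_nil.
rewrite big_cons (_ : (fun _ => _) = h i + (fun z => \sum_(i <- r) h i z)).
  exact: is_deriveD.
by apply/funext => z; rewrite big_cons.
Qed.

Lemma is_derive_bigprod (n : nat) (h : 'I_n -> V -> R) x X dh :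
  (forall i, is_derive x X (h i) (dh i)) ->
  is_derive x X (fun z => \prod_i h i z)
    (\sum_i \prod_j (if j == i then dh j else h j x)).
Proof.
elim: n h dh => [|n IHn] h dh hdh.
  rewrite big_ord0 (_ : (fun _ => _) = cst 1); first exact: is_derive_cst.
  by apply/funext => z; rewrite big_ord0.
rewrite (_ : (fun _ => _) =
    (fun z => \prod_(i < n) h (widen_ord (leqnSn n) i) z) * h ord_max).
  have hP := IHn _ _ (fun i => hdh (widen_ord (leqnSn n) i)).
  apply: (is_derive_eq (is_deriveM hP (hdh ord_max))).
  rewrite [RHS]big_ord_recr /= addrC; congr (_ + _).
    rewrite [RHS]big_ord_recr /= eqxx; congr (_ * _); apply: eq_bigr => i _.
    by rewrite ifN // -val_eqE /= ltn_eqF.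
  rewrite scaler_sumr; apply: eq_bigr => i _.
  rewrite [RHS]big_ord_recr /= ifN; last by rewrite -val_eqE /= gtn_eqF.
  by rewrite [RHS]mulrC; congr (_ * _); apply: eq_bigr.
by apply/funext => z; rewrite big_ord_recr.
Qed.

(** The product rule in each term of the Leibniz formula, regrouped by the row that is
    differentiated. *)
Lemma is_derive_det (n : nat) (A : V -> 'M[R]_n) x X dA :
  is_derive x X A dA ->
  is_derive x X (fun z => \det (A z))
    (\sum_i \det (subst_row i (row i dA) (A x))).
Proof.
move=> AdA; have AijdA i j := is_derive_coord i j AdA.
pose h s z := (-1) ^+ (s : 'S_n) * \prod_i A z i (s i).
pose dh s :=
  (-1) ^+ (s : 'S_n) *
  \sum_i \prod_j (if j == i then dA j (s j) else A x j (s j)).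
have hdh s : is_derive x X (h s) (dh s).
  rewrite (_ : h s = (-1) ^+ s *: (fun z => \prod_i A z i (s i))) //.
  by apply: is_deriveZ; exact: is_derive_bigprod.
apply: (is_derive_eq (is_derive_bigsum _ hdh)).
rewrite /dh; under eq_bigr do rewrite mulr_sumr.
rewrite exchange_big /=; apply: eq_bigr => i _; apply: eq_bigr => s _.
congr (_ * _); apply: eq_bigr => j _; rewrite subst_rowE mxE.
by case: eqP => // ->.
Qed.

Section PlaneValued.
Context {n m : nat}.
Implicit Types (w : V -> Lambda R n m) (v : V -> 'rV[R]_m).

Lemma is_derive_pairing w x X dw (f : 'M[R]_(n, m)) : is_derive x X w dw ->
  is_derive x X (fun z => pairing (w z) f) (pairing dw f).
Proof.
move=> wdw; apply: is_derive_bigsum => J.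
rewrite (_ : (fun _ => _) = wedge f 0 J *: (fun z => w z 0 J)).
  rewrite mulrC; apply: is_deriveZ; exact: is_derive_coord.
by apply/funext => z; rewrite mulrC.
Qed.

Lemma is_derive_wedge (e : V -> 'M[R]_(n, m)) x X de J : is_derive x X e de ->
  is_derive x X (fun z => wedge (e z) 0 J)
    ((\sum_i wedge (subst_row i (row i de) (e x))) 0 J).
Proof.
move=> ede.
have AdA : is_derive x X (fun z => colsub (enum_val J : {ffun _ -> _}) (e z))
    (colsub (enum_val J : {ffun _ -> _}) de).
  apply: is_derive_mx => i j; rewrite mxE.
  rewrite (_ : (fun _ => _) = fun z => e z i (enum_val J j)).
    exact: is_derive_coord.
  by apply/funext => z; rewrite mxE.
have := is_derive_det AdA.
rewrite (_ : (fun _ => _) = (fun z => wedge (e z) 0 J)); last first.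
  by apply/funext => z; rewrite mxE.
move=> /is_derive_eq; apply; rewrite summxE; apply: eq_bigr => i _.
rewrite mxE; congr (\det _); apply/matrixP => a b.
by rewrite !(subst_rowE, mxE).
Qed.

End PlaneValued.
End Derivatives.

(** * Differentiating a plane-valued map and a vector field in its planes *)

Section TautologicalSection.
Context {R : realType} {V : normedModType R} {n m : nat}.
Context {w : V -> Lambda R n m} {x X : V} {dw : Lambda R n m}.
Context (Qw : forall z, Qo (w z)) (wdw : is_derive x X w dw).
Let e := frame (w x).

Let we : positive_onb (w x) e. Proof. exact: frameP. Qed.
Let ee : e *m e^T = 1%:M. Proof. by case: we. Qed.
Let wE : w x = wedge e. Proof. by case: we. Qed.

Lemma pairing_derive_eq0 : pairing dw e = 0.
Proof.
(* Elements of [Qo] are unit vectors; differentiating the squared norm gives the claim. *)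
have normw z : \sum_J w z 0 J * w z 0 J = 1.
  have [f wf] := Qw z; rewrite -(pairing_onb wf).
  by apply: eq_bigr => J _; rewrite wf.2.
have coord J := is_derive_coord 0 J wdw.
have := is_derive_cst_eq0 normw
  (is_derive_bigsum _ (fun J => is_deriveM (coord J) (coord J))).
under eq_bigr do rewrite -mulr2n -mulr_natl.
rewrite -mulr_sumr => /eqP; rewrite mulf_eq0 pnatr_eq0 /= => /eqP dw0.
by rewrite -[RHS]dw0; apply: eq_bigr => J _; rewrite wE mulrC.
Qed.

(* Obtained by differentiating pairing_wedge_polar. *)
Lemma derive_wedge_polar :
  dw = \sum_(i < n) wedge (subst_row i (row i (polar dw e)) e).
Proof.
apply/rowP => J.
have polar_dw : is_derive x X (fun z => polar (w z) e) (polar dw e).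
  apply: is_derive_mx => i a; rewrite mxE.
  rewrite (_ : (fun _ => _) =
      fun z => pairing (w z) (subst_row i (delta_mx 0 a) e)).
    exact: is_derive_pairing.
  by apply/funext => z; rewrite mxE.
have polar_we : polar (w x) e = e.
  by rewrite wE polar_wedge ee adj1 trmx1 mul1mx.
have dpw := is_derive_pairing e wdw.
have dpwn : is_derive x X (fun z => pairing (w z) e ^+ n) 0.
  by move: (is_deriveX n dpw); rewrite pairing_derive_eq0 scaler0 exprfctE.
have relw z : pairing (w z) e * wedge (polar (w z) e) 0 J -
    pairing (w z) e ^+ n * w z 0 J = 0.
  have [f [_ <-]] := Qw z; apply/eqP; rewrite subr_eq0; apply/eqP.
  have /rowP/(_ J) := pairing_wedge_polar f e.
  by rewrite mxE => ->; rewrite mxE.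
have := is_derive_cst_eq0 relw (is_deriveB
  (is_deriveM dpw (is_derive_wedge J polar_dw))
  (is_deriveM dpwn (is_derive_coord 0 J wdw))).
(* At [x] the pairing is 1 with derivative 0 and the polar is [e], so only the derivatives of the
   wedge and of [w] remain. *)
rewrite polar_we pairing_derive_eq0 (pairing_onb we) !scaler0 !addr0.
rewrite expr1n !scale1r => /eqP; rewrite subr_eq0 => /eqP.
exact: esym.
Qed.

(** The entries are pairings of [dw] with [e] after row [i] is replaced by row [j]:
    [pairing_derive_eq0] if the indices agree, a repeated row otherwise. *)
Lemma polar_derive_perp : polar dw e *m e^T = 0.
Proof.
apply/trmx_inj; rewrite trmx_mul trmxK trmx0.
apply/matrixP => j i; rewrite [RHS]mxE.
transitivity ((row j e *m (polar dw e)^T) 0 i).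
  by rewrite -row_mul [RHS]mxE.
rewrite polarP.
have [<-|ij] := eqVneq i j.
  rewrite -pairing_derive_eq0; congr pairing; apply/matrixP => a b.
  by rewrite subst_rowE mxE; case: eqP => // ->.
rewrite /pairing big1 // => J _.
suff -> : wedge (subst_row i (row j e) e) 0 J = 0 by rewrite mulr0.
rewrite mxE; apply: (determinant_alternate ij) => a.
by rewrite !mxE eqxx eq_sym (negbTE ij) !mxE.
Qed.

Lemma tangent_of_hom_derive :
  exists u, Lperp (w x) u /\ tangent_of_hom (w x) u = dw.
Proof.
(* This map sends e_i to row [i] of [polar dw e] and kills the normal space. *)
exists (e^T *m polar dw e); split; first split.
- move=> v _; rewrite /in_perp -/e.
  by rewrite -!mulmxA polar_derive_perp !mulmx0.
- by move=> v vperp; rewrite mulmxA vperp mul0mx.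
rewrite tangent_of_homE -/e mulmxA ee mul1mx; exact/esym/derive_wedge_polar.
Qed.

Lemma derive_projN (v : V -> 'rV[R]_m) (dv : 'rV[R]_m) :
  (forall z, in_plane (w z) (v z)) -> is_derive x X v dv ->
  projN (w x) dv = v x *m hom_of_tangent (w x) dw.
Proof.
move=> vw vdv.
have [homp homdw] := hom_of_tangentP tangent_of_hom_derive.
set u := hom_of_tangent _ _ in homp homdw *.
apply: (@perp_eq _ _ _ (w x)); [exact: projN_perp|exact: homp.1|].
move=> y yperp; have ye : y *m e^T = 0 by [].
have dcoord (a : 'rV[R]_m) :
    is_derive x X (fun z => (a *m (v z)^T) 0 0) ((a *m dv^T) 0 0).
  rewrite mxE (_ : (fun _ => _) = fun z => \sum_b a 0 b * v z 0 b).
    apply: is_derive_bigsum => b; rewrite mxE.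
    by apply: (is_deriveZ (a 0 b)); exact: is_derive_coord.
  by apply/funext => z; rewrite mxE; apply: eq_bigr => b _; rewrite mxE.
(* Cramer's rule with [e] and [y] frozen at their values at [x], so that only [w] and [v] vary. *)
have cramer z : pairing (w z) e * (y *m (v z)^T) 0 0 -
    \sum_i pairing (w z) (subst_row i y e) * (row i e *m (v z)^T) 0 0 = 0.
  have [_ wf] := frameP (Qw z); rewrite -wf.
  by rewrite -pairing_cramer ?subrr //; exact: vw.
have := is_derive_cst_eq0 cramer (is_deriveB
  (is_deriveM (is_derive_pairing e wdw) (dcoord y))
  (is_derive_bigsum _ (fun i => is_deriveM
     (is_derive_pairing (subst_row i y e) wdw) (dcoord (row i e))))).
rewrite pairing_derive_eq0 (pairing_onb we) scaler0 addr0 scale1r.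
move/eqP; rewrite subr_eq0 => /eqP ydv.
have -> : (y *m (projN (w x) dv)^T) 0 0 = (y *m dv^T) 0 0.
  rewrite /projN /projT linearB /= mulmxBr !trmx_mul trmxK (mulmxA y) ye mul0mx.
  by rewrite subr0.
rewrite ydv; have /submxP[c vE] := vw x.
have -> : (y *m (v x *m u)^T) 0 0 = \sum_i c 0 i * (y *m (row i e *m u)^T) 0 0.
  rewrite vE -mulmxA trmx_mul mulmxA mxE; apply: eq_bigr => i _.
  rewrite mulrC [c^T _ _]mxE -row_mul; congr (_ * _).
  by rewrite [LHS]mxE [RHS]mxE; apply: eq_bigr => b _; rewrite !mxE.
apply: eq_bigr => i _.
(* Since [y] is normal, the terms carrying the derivative of [v] vanish on this side. *)
have -> : pairing (w x) (subst_row i y e) = 0.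
  by rewrite wE pairing_subst ye mul0mx mxE.
rewrite scale0r add0r -homdw pairing_tangent_of_hom // -/e.
have -> : (row i e *m (v x)^T) 0 0 = c 0 i; last by [].
by rewrite vE -/e trmx_mul mulmxA -row_mul ee row1 -rowE !mxE.
Qed.

End TautologicalSection.

(** * Smooth maps on manifolds *)

Section SmoothFunctions.
Context {R : realType} {V W : normedModType R}.
Implicit Types (U : set V).

Lemma is_diff_near0 (h : V -> W) (x : V) :
  (\forall y \near x, h y = 0) -> is_diff x h 0.
Proof.
move=> h0; have ho : h \o shift x = cst (h x) + (0 : V -> W) +o_ 0 id.
  apply/eqaddoP => _/posnumP[eps].
  have := h0; rewrite (near_shift 0) subr0; apply: filterS => y /= hy.
  by rewrite !fctE hy (nbhs_singleton h0) addr0 subrr normr0 mulr_ge0.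
have [c0 _] := dcst (0 : W) x.
have dh : 'd h x = 0 :> (V -> W) by exact/diff_unique.
by apply: DiffDef => //; apply/diff_locallyP; rewrite dh.
Qed.

(** [g] is [f] plus a function vanishing near [x], whose differential is 0. *)
Lemma near_eq_is_diff (f g df : V -> W) (x : V) :
  {near x, f =1 g} -> is_diff x f df -> is_diff x g df.
Proof.
move=> fg fdf; have h0 : \forall y \near x, (g - f) y = 0.
  by move: fg; apply: filterS => y fgy; rewrite !fctE fgy subrr.
rewrite -[g](addrNK f) addrC -[df]addr0.
exact: (is_diffD fdf (is_diff_near0 h0)).
Qed.

(** Equality on the open set [U] is equality near each of its points, so it passes to derivatives.
    The inductions below need this because rules such as [deriveB] hold only on [U]. *)
Lemma Ck_on_eq k U (f g : V -> W) : open U -> {in U, f =1 g} ->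
  Ck_on k U f -> Ck_on k U g.
Proof.
move=> Uo; have near_eq (h l : V -> W) x :
    {in U, h =1 l} -> x \in U -> {near x, h =1 l}.
  move=> hl xU; have := open_nbhs_nbhs (conj Uo (set_mem xU)).
  by apply: filterS => y yU; apply: hl; rewrite inE.
elim: k f g => [|k IHk] f g fg.
  move=> fcont x xU; have nfg := near_eq _ _ _ fg xU.
  rewrite /continuous_at -(nbhs_singleton nfg).
  apply: cvg_trans (fcont x xU); exact: near_eq_cvg.
move=> [fdiff fCk]; split=> [x xU|v].
  have nfg := near_eq _ _ _ fg xU.
  by have [] := near_eq_is_diff nfg (differentiableP (fdiff x xU)).
apply: (IHk _ _ _ (fCk v)) => x xU; apply: near_eq_derive; exact: near_eq.
Qed.

Lemma Ck_on_sub k U (f g : V -> W) : open U ->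
  Ck_on k U f -> Ck_on k U g -> Ck_on k U (f - g).
Proof.
move=> Uo; elim: k f g => [|k IHk] f g.
  by move=> fcont gcont x xU; apply: continuousB; [exact: fcont|exact: gcont].
move=> [fdiff fCk] [gdiff gCk]; split=> [x xU|v].
  by apply: differentiableB; [exact: fdiff|exact: gdiff].
apply: (Ck_on_eq Uo _ (IHk _ _ (fCk v) (gCk v))) => x xU.
by rewrite deriveB //; apply: diff_derivable; [exact: fdiff|exact: gdiff].
Qed.

End SmoothFunctions.

Section LinearImage.
Context {R : realType} {V W W' : normedModType R}.
Context {L : {linear W -> W'}} (Lcont : continuous L).

(** [L] commutes with difference quotients and, by continuity, with their limit. It is applied below
    to the projections [fst] and [snd]. *)
Lemma is_derive_linear (f : V -> W) x X df :
  is_derive x X f df -> is_derive x X (L \o f) (L df).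
Proof.
move=> [fx <-].
have h : (fun h => h^-1 *: ((L \o f) (h *: X + x) - (L \o f) x)) @ 0^' -->
    L ('D_X f x).
  rewrite (_ : (fun h => _) = L \o (fun h => h^-1 *: (f (h *: X + x) - f x))).
    by apply: continuous_cvg => //; exact: Lcont.
  by apply/funext => h /=; rewrite [RHS]linearZ /= -linearB.
by apply: DeriveDef; [apply/cvg_ex; exists (L ('D_X f x))|exact: cvg_lim].
Qed.

Lemma Ck_on_linear k (U : set V) (f : V -> W) : open U ->
  Ck_on k U f -> Ck_on k U (L \o f).
Proof.
move=> Uo; elim: k f => [|k IHk] f.
  by move=> fcont x xU; apply: continuous_comp; [exact: fcont|exact: Lcont].
move=> [fdiff fCk]; split=> [x xU|v].
  apply: differentiable_comp; first exact: fdiff.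
  exact: linear_differentiable.
apply: (Ck_on_eq Uo _ (IHk _ (fCk v))) => x xU.
apply/esym; apply: derive_val; apply: is_derive_linear => //.
by apply: derivableP; apply: diff_derivable; exact: fdiff.
Qed.

End LinearImage.

(** * Tangent vectors and differentials in charts *)

Section Manifold.
Context {R : realType} {n : nat} {M : orientedManifold R n}.
Implicit Types (x : M).

Definition chart_at x : chart R n M := atlas M (index_at x).

Lemma chart_at_dom x : chart_dom (chart_at x) x.
Proof. exact: (projT2 (cid (atlas_cover x))). Qed.

Lemma chart_atK x : chart_inv (chart_at x) (chart_fwd (chart_at x) x) = x.
Proof. by apply: chart_fwdK; rewrite inE; exact: chart_at_dom. Qed.

Lemma smooth_differentiable (W : normedModType R) (f : M -> W) x : smooth f ->
  differentiable (f \o chart_inv (chart_at x)) (chart_fwd (chart_at x) x).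
Proof.
move=> /(_ (index_at x) 1%N)[fdiff _]; apply: fdiff.
by rewrite inE; exists x => //; exact: chart_at_dom.
Qed.

Lemma dmap_is_derive (W : normedModType R) (f : M -> W) x (X : tangent x) :
  smooth f ->
  is_derive (chart_fwd (chart_at x) x) (tcoord X (index_at x))
    (f \o chart_inv (chart_at x)) (dmap f X).
Proof.
move=> /(@smooth_differentiable _ f x) fdiff; rewrite /dmap -deriveE //.
by apply: derivableP; exact: diff_derivable.
Qed.

Lemma smooth_sub (W : normedModType R) (f g : M -> W) :
  smooth f -> smooth g -> smooth (fun x => f x - g x).
Proof.
move=> fs gs i k.
exact: (Ck_on_sub (chart_cod_open (c := _)) (fs i k) (gs i k)).
Qed.

Lemma smooth_linear (W W' : normedModType R) (L : {linear W -> W'})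
    (f : M -> W) :
  continuous L -> smooth f -> smooth (fun x => L (f x)).
Proof.
move=> Lc fs i k.
exact: (Ck_on_linear Lc (chart_cod_open (c := _)) (fs i k)).
Qed.

Lemma dmap_sub (W : normedModType R) (f g : M -> W) x (X : tangent x) :
  smooth f -> smooth g -> dmap (fun y => f y - g y) X = dmap f X - dmap g X.
Proof.
move=> fs gs.
have [_ <-] := is_deriveB (dmap_is_derive X fs) (dmap_is_derive X gs).
by have [_ <-] := dmap_is_derive X (smooth_sub fs gs).
Qed.

Local Notation dom i := (chart_dom (atlas M i)).
Local Notation fwd i := (chart_fwd (atlas M i)).
Local Notation inv i := (chart_inv (atlas M i)).
Local Notation trans i j := (transition (atlas M i) (atlas M j)).

Lemma chart_inv_near (i j : atlas_index M) x :
  dom i x -> dom j x -> \forall y \near fwd i x, dom j (inv i y).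
Proof.
move=> xi xj; have xcod : fwd i x \in fwd i @` dom i by rewrite inE; exists x.
apply: (chart_inv_continuous xcod).
rewrite chart_fwdK ?inE //; apply: open_nbhs_nbhs; split=> //.
exact: chart_dom_open.
Qed.

Lemma transition_differentiable (i j : atlas_index M) x :
  dom i x -> dom j x -> differentiable (trans i j) (fwd i x).
Proof.
move=> xi xj; have [tdiff _] := @atlas_smooth _ _ M i j 1%N.
by apply: tdiff; rewrite inE; exists x.
Qed.

(** The chain rule; the transition maps compose as expected only near [fwd i x], where [inv i] stays
    in the domain of chart [j]. *)
Lemma diff_transition_comp (i j l : atlas_index M) x :
  dom i x -> dom j x -> dom l x ->
  'd (trans i l) (fwd i x) =
  'd (trans j l) (fwd j x) \o 'd (trans i j) (fwd i x) :> (_ -> _).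
Proof.
move=> xi xj xl.
have tx : trans i j (fwd i x) = fwd j x.
  by rewrite /transition /= chart_fwdK // inE.
have dij := differentiableP (transition_differentiable xi xj).
have := differentiableP (transition_differentiable xj xl); rewrite -tx => djl.
suff near_comp : {near fwd i x, trans j l \o trans i j =1 trans i l}.
  by have [_] := near_eq_is_diff near_comp (is_diff_comp dij djl).
have := chart_inv_near xi xj; apply: filterS => y yj.
by rewrite /transition /= chart_fwdK // inE.
Qed.

Lemma diff_transition_id (i : atlas_index M) x : dom i x ->
  'd (trans i i) (fwd i x) = id :> (_ -> _).
Proof.
move=> xi; suff near_id : {near fwd i x, id =1 trans i i}.
  by have [_] := near_eq_is_diff near_id (is_diff_id _).
have iopen := @chart_cod_open _ _ _ (atlas M i).
have : nbhs (fwd i x) (fwd i @` dom i).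
  by apply: open_nbhs_nbhs; split=> //; exists x.
apply: filterS => _ [z zi <-].
by rewrite /transition /= chart_fwdK // inE.
Qed.

(** The vector [c] is carried from the preferred chart to the others by the differentials of the
    transitions; their cocycle rule gives compatibility. *)
Lemma tangent_of_coord x (c : 'rV[R]_n) :
  exists X : tangent x, tcoord X (index_at x) = c.
Proof.
pose i0 := index_at x; have x0 : dom i0 x := chart_at_dom x.
pose t j : 'rV[R]_n := if pselect (dom j x) is left _ then
  'd (trans i0 j) (fwd i0 x) c else 0.
have t_in j : dom j x -> t j = 'd (trans i0 j) (fwd i0 x) c.
  by rewrite /t; case: pselect.
have t_out j : ~ dom j x -> t j = 0.
  by rewrite /t; case: pselect.
move: t t_in t_out => t t_in t_out.
have t_trans i j : dom i x -> dom j x ->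
    t j = 'd (trans i j) (fwd i x) (t i).
  move=> xi xj; rewrite (t_in _ xj) (t_in _ xi).
  exact: (congr1 (fun h => h c) (diff_transition_comp x0 xi xj)).
exists (Tangent t_trans t_out) => /=; rewrite (t_in _ x0).
exact: (congr1 (fun h => h c) (diff_transition_id x0)).
Qed.

Lemma tangent_rows x (T : 'M[R]_n) :
  exists X : 'I_n -> tangent x, \matrix_i tcoord (X i) (index_at x) = T.
Proof.
have /choice[X XT] i := tangent_of_coord x (row i T).
by exists X; apply/row_matrixP => i; rewrite rowK XT.
Qed.

(** [J] is the Jacobian in the preferred chart; it reduces questions on tangent frames to matrix
    algebra. *)
Lemma dmap_rowsE (m : nat) (f : M -> 'rV[R]_m) x :
  exists J : 'M[R]_(n, m),
    (forall X : tangent x, dmap f X = tcoord X (index_at x) *m J) /\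
    (forall X : 'I_n -> tangent x,
      dmap_rows f X = (\matrix_i tcoord (X i) (index_at x)) *m J).
Proof.
pose J := lin1_mx ('d (f \o chart_inv (chart_at x)) (chart_fwd (chart_at x) x)).
have dJ (X : tangent x) : dmap f X = tcoord X (index_at x) *m J.
  by rewrite mul_rV_lin1.
exists J; split=> // X; apply/row_matrixP => i.
by rewrite row_mul !rowK dJ.
Qed.

End Manifold.

(** * The affine Gauss map and the equation for the section *)

Section AffineGaussMap.
Context {R : realType} {n m : nat} {M : orientedManifold R n}.
Context {phibar : M -> Lambda R n m * 'rV[R]_m} (hphibar : smooth_to_Q phibar).
Implicit Types (x : M).

Let Qw x : Qo (phibar x).1. Proof. by case: (hphibar.2 x). Qed.

Let fst_continuous : continuous (fst : Lambda R n m * 'rV[R]_m -> Lambda R n m).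
Proof. by move=> p; exact: cvg_fst. Qed.

Let snd_continuous : continuous (snd : Lambda R n m * 'rV[R]_m -> 'rV[R]_m).
Proof. by move=> p; exact: cvg_snd. Qed.

Lemma smooth_v : smooth (fun x => (phibar x).2).
Proof. exact: (smooth_linear (L := snd) snd_continuous hphibar.1). Qed.

Lemma projN_dv x (X : tangent x) :
  projN (phibar x).1 (dmap (fun y => (phibar y).2) X) =
  alpha (phibar x) (dmap phibar X).
Proof.
have dphibar := dmap_is_derive X hphibar.1.
have dw := is_derive_linear (L := fst) fst_continuous dphibar.
(* [chart_inv] is total with values in [M], so the conditions on [phibar] hold at every [z], even
   outside the chart. *)
have := derive_projN (fun z => Qw _) dw
  (fun z => (hphibar.2 _).2) (dmap_is_derive X smooth_v).
by rewrite /alpha /= chart_atK.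
Qed.

(* An empty set of candidates would give gauss_plane phi x = 0, the default
   value of get, which is not in Qo. *)
Lemma gauss_planeP (phi : M -> 'rV[R]_m) x : Qo (gauss_plane phi x) ->
  exists X : 'I_n -> tangent x,
    positive_basis X /\ positive_onb (gauss_plane phi x) (dmap_rows phi X).
Proof.
rewrite /gauss_plane; set S := [set w | _] => QS.
have [[w Sw]|S0] := pselect (exists w, S w).
  exact: (getPex (ex_intro _ w Sw)).
exfalso; apply: (@Qo_neq0 R n m); move: QS.
rewrite getPN => [|w Sw]; last by apply: S0; exists w.
by congr (Qo _); apply/rowP => J; rewrite [LHS]mxE [RHS]mxE.
Qed.

Lemma positive_basis_dmap (phi : M -> 'rV[R]_m) x (X0 : 'I_n -> tangent x) :
  positive_basis X0 ->
  (forall X : tangent x, (dmap phi X <= dmap_rows phi X0)%MS) /\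
  (forall X : 'I_n -> tangent x, positive_basis X ->
    exists2 A : 'M[R]_n, 0 < \det A & dmap_rows phi X = A *m dmap_rows phi X0).
Proof.
rewrite /positive_basis => X0_gt0; have [J [dJ rowsJ]] := dmap_rowsE phi x.
set T0 := (\matrix_i _) in X0_gt0; have T0_unit : T0 \in unitmx.
  by rewrite unitmxE unitfE gt_eqF.
have rows0 : dmap_rows phi X0 = T0 *m J by [].
split=> [X|X X_gt0].
  apply/submxP; exists (tcoord X (index_at x) *m invmx T0).
  by rewrite dJ rows0 mulmxA mulmxKV.
exists ((\matrix_i tcoord (X i) (index_at x)) *m invmx T0).
  by rewrite det_mulmx det_inv mulr_gt0 ?invr_gt0.
by rewrite rows0 mulmxA mulmxKV.
Qed.

(** Preservation of orientation is included for the final equivalence. *)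
Lemma affine_gauss_map_section (phi : M -> 'rV[R]_m) : smooth phi ->
    (forall x, affine_gauss_map phi x = phibar x) ->
  let s := fun x => phi x - (phibar x).2 in
  [/\ section_EN phibar s,
      forall x (X : tangent x), nablaN phibar s X = beta phibar X &
      preserves_orientation phibar phi].
Proof.
move=> sphi gauss s.
have wE x : gauss_plane phi x = (phibar x).1 by rewrite -gauss.
have vE x : (phibar x).2 = projT (phibar x).1 (phi x) by rewrite -gauss.
have frames x : exists X : 'I_n -> tangent x,
    positive_basis X /\ positive_onb (phibar x).1 (dmap_rows phi X).
  by rewrite -wE; apply: gauss_planeP; rewrite wE.
split.
- split=> [|x]; first exact: smooth_sub sphi smooth_v.
  by rewrite /s vE; exact: projN_perp.
- move=> x X; have [X0 [X0_gt0 onb]] := frames x.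
  (* The differential of [phi] has no normal part, so that of [s] has the normal part of [- dv],
     which is [beta]. *)
  rewrite /nablaN (dmap_sub X sphi smooth_v) /beta -projN_dv.
  have [/(_ X) /submxP[c dX] _] := positive_basis_dmap phi X0_gt0.
  have dX_proj : projT (phibar x).1 (dmap phi X) = dmap phi X.
    by rewrite (projT_onb _ onb) dX -(mulmxA c) onb.1 mulmx1.
  by rewrite projNB [X in X - _]/projN dX_proj subrr sub0r.
- move=> x X X_gt0; have [X0 [X0_gt0 onb]] := frames x.
  have [_ /(_ X X_gt0) [A A_gt0 ->]] := positive_basis_dmap phi X0_gt0.
  rewrite -mulmxA det_mulmx (onb_change_det (frameP (Qw x)) onb) mulr1.
  exact: A_gt0.
Qed.

Lemma section_affine_gauss_map (s : M -> 'rV[R]_m) :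
    section_EN phibar s ->
    (forall x (X : tangent x), nablaN phibar s X = beta phibar X) ->
  let phi := fun x => s x + (phibar x).2 in
  smooth phi -> preserves_orientation phibar phi ->
  forall x, affine_gauss_map phi x = phibar x.
Proof.
move=> [_ s_perp] nabla_s phi sphi phi_or x.
set w := (phibar x).1; set e := frame w; have [ee we] := frameP (Qw x).
have sE : s = fun y => phi y - (phibar y).2.
  by apply/funext => y; rewrite /phi addrK.
have dphi_plane (X : tangent x) : dmap phi X *m e^T *m e = dmap phi X.
  have := nabla_s x X; rewrite /nablaN {1}sE (dmap_sub X sphi smooth_v).
  rewrite /beta -projN_dv projNB => /(canRL (subrK _)).
  by rewrite addNr => /subr0_eq.
have [J [dJ rowsJ]] := dmap_rowsE phi x; pose A := J *m e^T.
(* [A] is the matrix of the differential of [phi] in the basis [e]. *)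
have JE : J = A *m e.
  apply/row_matrixP => i; have [X Xi] := tangent_of_coord x (delta_mx 0 i).
  by rewrite /A -mulmxA !rowE -Xi mulmxA -dJ mulmxA.
have A_gt0 : 0 < \det A.
  have [X X1] := tangent_rows x 1%:M.
  have := phi_or x X; rewrite /positive_basis X1 det1 rowsJ X1 mul1mx.
  exact.
have A_unit : A \in unitmx by rewrite unitmxE unitfE gt_eqF.
have gaussE : gauss_plane phi x = w.
  (* The frame with coordinates [invmx A] is mapped to [e], so [w] is a candidate in the definition
     of [gauss_plane]. *)
  have [X XA] := tangent_rows x (invmx A).
  have w_gauss : exists w', exists X : 'I_n -> tangent x,
      positive_basis X /\ positive_onb w' (dmap_rows phi X).
    exists w, X; rewrite /positive_basis XA det_inv invr_gt0; split=> //.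
    by rewrite rowsJ XA JE mulKmx.
  have [Y [Y_gt0 [Yonb wY]]] : exists Y : 'I_n -> tangent x,
      positive_basis Y /\ positive_onb (gauss_plane phi x) (dmap_rows phi Y).
    exact: getPex w_gauss.
  (* The plane chosen by [get] has a basis [C *m e] with [C] orthogonal of positive determinant;
     hence this determinant is 1 and the plane is [w]. *)
  move: Yonb wY; rewrite rowsJ JE mulmxA; set C := _ *m A => Conb <-.
  have C_gt0 : 0 < \det C by rewrite det_mulmx mulr_gt0.
  clearbody C; have : \det C ^+ 2 = 1.
    rewrite expr2 -[X in _ * X]det_tr -det_mulmx -[RHS](det1 _ n) -Conb.
    by rewrite trmx_mul mulmxA -(mulmxA C) ee mulmx1.
  move/eqP; rewrite sqrf_eq1 => /orP[/eqP C1|/eqP CN1].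
    by rewrite wedge_mul C1 scale1r.
  by move: C_gt0; rewrite CN1 ltr0N1.
rewrite /affine_gauss_map gaussE.
have -> : projT w (phi x) = (phibar x).2; last exact/esym/surjective_pairing.
rewrite /projT /phi mulmxDl (s_perp x) add0r.
exact: (in_planeP _ (Qw x)).1 (hphibar.2 x).2.
Qed.

End AffineGaussMap.

Theorem theorem1 (R : realType) (n k : nat) (M : orientedManifold R n)
    (phibar : M -> Lambda R n (n + k) * 'rV[R]_(n + k))
    (hphibar : smooth_to_Q phibar) :
  (forall phi : M -> 'rV[R]_(n + k),
     immersion phi ->
     (forall x, affine_gauss_map phi x = phibar x) ->
     let s := fun x => phi x - (phibar x).2 in
     section_EN phibar s /\
     (forall (x : M) (X : tangent x), nablaN phibar s X = beta phibar X))
  /\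
  (forall s : M -> 'rV[R]_(n + k),
     section_EN phibar s ->
     (forall (x : M) (X : tangent x), nablaN phibar s X = beta phibar X) ->
     let phi := fun x => s x + (phibar x).2 in
     immersion phi ->
     preserves_orientation phibar phi ->
     forall x, affine_gauss_map phi x = phibar x)
  /\
  ((exists phi : M -> 'rV[R]_(n + k),
      immersion phi /\ (forall x, affine_gauss_map phi x = phibar x))
   <->
   (exists s : M -> 'rV[R]_(n + k),
      [/\ section_EN phibar s,
          (forall (x : M) (X : tangent x), nablaN phibar s X = beta phibar X),
          immersion (fun x => s x + (phibar x).2) &
          preserves_orientation phibar (fun x => s x + (phibar x).2)])).
Proof.
split; [|split].
- move=> phi [sphi _] gauss s.
  by have [] := affine_gauss_map_section hphibar sphi gauss.
- move=> s sec nabla_s phi [sphi _] phi_or.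
  exact: section_affine_gauss_map.
split=> [[phi [imm gauss]]|[s [sec nabla_s imm phi_or]]].
  have [sec nabla_s phi_or] := affine_gauss_map_section hphibar imm.1 gauss.
  exists (fun x => phi x - (phibar x).2).
  have -> : (fun x => phi x - (phibar x).2 + (phibar x).2) = phi.
    by apply/funext => x; rewrite subrK.
  by split.
exists (fun x => s x + (phibar x).2); split=> //.
by case: imm => sphi _; exact: section_affine_gauss_map.
Qed.
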